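(* Let $L$ be an oriented link in $S^3$, let $n\ge 1$, and let $w$ be a word in the symbols $\sigma_1,\dots,\sigma_{n-1},\sigma_1^{-1},\dots,\sigma_{n-1}^{-1}$ representing a braid in the braid group $B_n$ whose closure is $L$. Let $$A(w)=\frac{1}{[n]}\sum_{(\mathbf{x},\varepsilon)\in\mathcal{S}(w)}\langle\varepsilon\rangle\,M(w,\mathbf{x},\varepsilon)\in\mathbb{C}(v)$$ be the state-sum defined in the context. Then $A(w)$ is a polynomial in $v-v^{-1}$, and $$A(w)=\Delta(L),$$ where $\Delta(L)$ is the Conway-normalized Alexander polynomial of $L$ (in the variable $v-v^{-1}$).
   Context: Here $v$ is an indeterminate and $[r]=\dfrac{v^r-v^{-r}}{v-v^{-1}}$ for $r\in\mathbb{Z}$. Braids. $B_n$ is the braid group on $n$ strands with generators $\sigma_1,\dots,\sigma_{n-1}$ and relations $\sigma_r\sigma_{r+1}\sigma_r=\sigma_{r+1}\sigma_r\sigma_{r+1}$ for $1\le r\le n-2$, and $\sigma_r\sigma_s=\sigma_s\sigma_r$ for $|r-s|>1$. A word $w$ is pictured as a braid diagram drawn up the page as the word is read from right to left (the rightmost letter is at the bottom). Strands are oriented upward. The letter $\sigma_r$ is the positive crossing in which the strand going from bottom position $r$ to top position $r+1$ passes over the strand going from bottom position $r+1$ to top position $r$; $\sigma_r^{-1}$ is the negative crossing, with the over/under roles exchanged. Permutation diagrams. A permutation diagram $\mathbf{x}$ for $w$ is obtained from the braid diagram by replacing each crossing (each letter $\sigma_r^{\pm1}$ of $w$) by one of two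 resolutions: either two vertical strands in positions $r$ and $r+1$ (identity), or a transverse crossing of the strands in positions $r$ and $r+1$ (without over/under information). It is admissible if (P1) the first (leftmost) strand goes straight through without crossing any other strand, and (P2) the underlying permutation (bottom to top) is the identity. States. A state for $w$ is a pair $(\mathbf{x},\varepsilon)$ where $\mathbf{x}$ is an admissible permutation diagram for $w$ and $\varepsilon=(\varepsilon_1,\dots,\varepsilon_n)$ is an assignment of a sign in $\{+,-\}$ to each of the $n$ strands of $\mathbf{x}$ ($\varepsilon_j$ being the sign of the strand starting at position $j$) such that (S1) $\varepsilon_1=+$, and (S2) no two strands of the same sign cross in $\mathbf{x}$. The set of states is $\mathcal{S}(w)$. The number $\langle\varepsilon\rangle\in\{\pm1\}$ is the product of the signs $\varepsilon_1,\dots,\varepsilon_n$. Weights. $M(w,\mathbf{x},\varepsilon)\in\mathbb{C}(v)$ is the product of scalars, one for each letter of $w$. For a letter $\sigma_r$, let $(\alpha,\beta)$ be the signs of the strands of $\mathbf{x}$ occupying positions $r$ and $r+1$, respectively, just below that resolved crossing. The scalar is: - if the crossing is resolved as two vertical strands: $v$ if $(\alpha,\beta)=(+,+)$; $-v^{-1}$ if $(-,-)$; $\dfrac{v^r}{[r]}$ if $(-,+)$; $\dfrac{-v^{-r}}{[r]}$ if $(+,-)$; - if the crossing is resolved as a transverse crossing: $\dfrac{[r+1]}{[r]}$ if $(-,+)$; $\dfrac{[r-1]}{[r]}$ if $(+,-)$. For a letter $\sigma_r^{-1}$, use the same scalars with $v$ replaced by $v^{-1}$. Conway normalization. $\Delta$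 is the invariant of oriented links determined by $\Delta(\text{unknot})=1$ and the skein relation $\Delta(L_+)-\Delta(L_-)=(v-v^{-1})\Delta(L_0)$, where $L_+,L_-,L_0$ are identical outside a ball in which they are respectively a positive crossing, a negative crossing, and the oriented smoothing. *)

(* Defs.v *)
From HB Require Import structures.
From Stdlib Require Import Relations.
From mathcomp Require Import all_boot all_order all_algebra all_fingroup.
From mathcomp Require Import reals complex.

Set Implicit Arguments.
Unset Strict Implicit.
Unset Printing Implicit Defensive.

Import GRing.Theory.
Local Open Scope ring_scope.

(* Oriented links are given by their planar diagrams in Morse position, cut by
   horizontal lines into elementary slices, and taken up to ambient isotopy:
   the planar isotopies together with the Reidemeister moves (Freyd-Yetter,
   Turaev).  A diagram is the list of its slices from bottom to top.
   Positions along a horizontal line count from 0, from left to right.  The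
   orientation of the points of a horizontal line is a [seq bool]: [true] for
   a strand running upward, [false] for one running downward. *)

Inductive gen : Type :=
  | Cup of bool    (* local minimum; the sign orients its left end *)
  | Cap            (* local maximum *)
  | Cross of bool. (* [true]: the strand from bottom left to top right is over *)

(* [(i, g)] has i vertical strands on the left of g. *)
Definition slice : Type := nat * gen.

Definition slice_step (a : slice) (s : seq bool) : option (seq bool) :=
  let: (i, g) := a in
  if (i <= size s)%N then
    match g, drop i s with
    | Cup o, r => Some (take i s ++ [:: o, ~~ o & r])
    | Cap, x :: y :: r => if x != y then Some (take i s ++ r) else None
    | Cross _, x :: y :: r => Some (take i s ++ [:: y, x & r])
    | _, _ => None
    end
  else None.

Fixpoint run (d : seq slice) (s : seq bool) : option (seq bool) :=
  if d is a :: d' then obind (run d') (slice_step a s) else Some s.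

Definition is_closed (d : seq slice) : bool := run d [::] == Some [::].

Record link_diagram : Type :=
  LinkDiagram { slices :> seq slice; slicesP : is_closed slices }.

Definition nin (g : gen) : nat := if g is Cup _ then 0 else 2.
Definition nout (g : gen) : nat := if g is Cap then 0 else 2.

Inductive local_move : seq slice -> seq slice -> Prop :=
  (* exchange of the heights of two slices lying side by side *)
  | lm_far i k g h :
      local_move [:: (i, g); ((i + nout g + k)%N, h)]
                 [:: ((i + nin g + k)%N, h); (i, g)]
  (* cancellation of a maximum and a minimum *)
  | lm_zigzag_l i o : local_move [:: (i.+1, Cup o); (i, Cap)] [::]
  | lm_zigzag_r i o : local_move [:: (i, Cup o); (i.+1, Cap)] [::]
  (* a strand passing over or under a minimum or a maximum *)
  | lm_slide_cup i o b :
      local_move [:: (i, Cup o); (i.+1, Cross b)]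
                 [:: (i.+1, Cup o); (i, Cross (~~ b))]
  | lm_slide_cap i b :
      local_move [:: (i, Cross b); (i.+1, Cap)]
                 [:: (i.+1, Cross (~~ b)); (i, Cap)]
  (* Reidemeister moves *)
  | lm_R1_l i o b :
      local_move [:: (i, Cup o); (i.+1, Cross b); (i, Cap)] [::]
  | lm_R1_r i o b :
      local_move [:: (i.+1, Cup o); (i, Cross b); (i.+1, Cap)] [::]
  | lm_R2 i b : local_move [:: (i, Cross b); (i, Cross (~~ b))] [::]
  | lm_R3 i b :
      local_move [:: (i, Cross b); (i.+1, Cross b); (i, Cross b)]
                 [:: (i.+1, Cross b); (i, Cross b); (i.+1, Cross b)].

Inductive diagram_move (D E : link_diagram) : Prop :=
  Move u a b t of local_move a b
    & slices D = u ++ a ++ t & slices E = u ++ b ++ t.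

Definition isotopic : link_diagram -> link_diagram -> Prop :=
  clos_refl_sym_trans link_diagram diagram_move.

Lemma unknot_closed o : is_closed [:: (0%N, Cup o); (0%N, Cap)].
Proof. by case: o. Qed.

Definition unknot (o : bool) : link_diagram := LinkDiagram (unknot_closed o).

(* Up to isotopy any crossing can be turned so that both of its strands run
   upward; [Cross true] is then the positive crossing. *)
Definition skein_triple (Lp Lm L0 : link_diagram) : Prop :=
  exists u i t s,
    [/\ slices Lp = u ++ (i, Cross true) :: t,
        slices Lm = u ++ (i, Cross false) :: t,
        slices L0 = u ++ t,
        run u [::] = Some s
      & nth false s i && nth false s i.+1].

Notation ratfun R := {fraction {poly R[i]%C}}.

Definition vvar (R : realType) : ratfun R := tofrac 'X.

Definition is_conway (R : realType) (Delta : link_diagram -> ratfun R) : Prop :=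
  [/\ forall D E, isotopic D E -> Delta D = Delta E,
      forall o, Delta (unknot o) = 1
    & forall Lp Lm L0, skein_triple Lp Lm L0 ->
        Delta Lp - Delta Lm = (vvar R - (vvar R)^-1) * Delta L0].

(* The braid group on m.+1 strands has m generators: [(i, true)] stands for
   sigma_(i+1) and [(i, false)] for its inverse. *)
Definition letter (m : nat) : Type := ('I_m * bool)%type.

(* Words are read from right to left up the page, hence the [rev].  The m.+1
   strands are closed up by nested arcs on the right. *)
Definition braid_closure_slices (m : nat) (w : seq (letter m)) : seq slice :=
  [seq (k, Cup true) | k <- iota 0 m.+1]
  ++ [seq (nat_of_ord l.1, Cross l.2) | l <- rev w]
  ++ [seq (k, Cap) | k <- rev (iota 0 m.+1)].

Lemma run_cat d e s : run (d ++ e) s = obind (run e) (run d s).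
Proof. by elim: d s => [|a d IH] s //=; case: slice_step => //= r; apply: IH. Qed.

Definition bdry k : seq bool := nseq k true ++ nseq k false.

Lemma run_cups k :
  run [seq (j, Cup true) | j <- iota 0 k] [::] = Some (bdry k).
Proof.
elim: k => // k IH.
rewrite -addn1 iotaD map_cat run_cat IH add0n /= /bdry.
rewrite size_cat !size_nseq leq_addr drop_size_cat ?size_nseq //.
rewrite take_size_cat ?size_nseq //= addn1.
by rewrite -[in nseq k.+1 true]addn1 nseqD -catA.
Qed.

Lemma run_caps k :
  run [seq (j, Cap) | j <- rev (iota 0 k)] (bdry k) = Some [::].
Proof.
elim: k => // k IH.
rewrite -{1}addn1 iotaD rev_cat /= add0n.
have -> : bdry k.+1 = nseq k true ++ [:: true, false & nseq k false].
  by rewrite /bdry -[in nseq k.+1 true]addn1 nseqD -catA.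
rewrite size_cat !size_nseq (leqW (leq_addr _ _)) drop_size_cat ?size_nseq //.
by rewrite take_size_cat ?size_nseq.
Qed.

Lemma step_cross b x y (s t : seq bool) :
  slice_step (size s, Cross b) (s ++ [:: x, y & t])
  = Some (s ++ [:: y, x & t]).
Proof.
by rewrite /slice_step size_cat leq_addr drop_size_cat // take_size_cat.
Qed.

Lemma run_cross (m : nat) (w : seq (letter m)) :
  run [seq (nat_of_ord l.1, Cross l.2) | l <- w] (bdry m.+1) = Some (bdry m.+1).
Proof.
elim: w => // -[i b] w IH.
have e : bdry m.+1
    = nseq i true ++ [:: true, true & nseq (m - i.+1) true ++ nseq m.+1 false].
  by rewrite /bdry -{1}(subnKC (ltn_ord i)) -addnS addSnnS nseqD -catA.
have := step_cross b true true (nseq i true)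
  (nseq (m - i.+1) true ++ nseq m.+1 false).
by rewrite -e size_nseq map_cons -cat1s run_cat /run => ->.
Qed.

Lemma braid_closure_closed (m : nat) (w : seq (letter m)) :
  is_closed (braid_closure_slices w).
Proof.
have runS d e s s' : run d s = Some s' -> run (d ++ e) s = run e s'.
  by rewrite run_cat => ->.
apply/eqP; rewrite /braid_closure_slices (runS _ _ _ _ (run_cups _)).
by rewrite (runS _ _ _ _ (run_cross _)) run_caps.
Qed.

Definition braid_closure (m : nat) (w : seq (letter m)) : link_diagram :=
  LinkDiagram (braid_closure_closed w).

(* A permutation diagram resolves every letter of the word: [true] for a
   transverse crossing, [false] for two vertical strands.  A resolved word is
   the list of the letters paired with their resolutions; like the word it is
   listed from top to bottom, so the tail of a resolved word is the part of
   the diagram below its first letter. *)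
Definition resolved (m : nat) : Type := seq (letter m * bool).

Definition lpos (m : nat) (l : letter m) : 'I_m.+1 := widen_ord (leqnSn m) l.1.
Definition rpos (m : nat) (l : letter m) : 'I_m.+1 := lift ord0 l.1.

(* [strand d p] is the bottom end of the strand whose top end is p. *)
Fixpoint strand (m : nat) (d : resolved m) : 'S_m.+1 :=
  if d is (l, c) :: d' then
    ((if c then tperm (lpos l) (rpos l) else 1) * strand d')%g
  else 1%g.

Fixpoint all_crossings (m : nat) (P : rel 'I_m.+1) (d : resolved m) : bool :=
  if d is (l, c) :: d' then
    (c ==> P (strand d' (lpos l)) (strand d' (rpos l))) && all_crossings P d'
  else true.

Definition admissible (m : nat) (d : resolved m) : bool :=
  all_crossings (fun a b => (a != ord0) && (b != ord0)) d
  && (strand d == 1%g).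

(* Signs: [true] is +, [false] is -. *)
Definition is_state (m : nat) (d : resolved m) (eps : {ffun 'I_m.+1 -> bool}) :
    bool :=
  [&& admissible d, eps ord0 & all_crossings (fun a b => eps a != eps b) d].

Definition states (m : nat) (w : seq (letter m)) :
    {set (size w).-tuple bool * {ffun 'I_m.+1 -> bool}} :=
  [set s : (size w).-tuple bool * {ffun 'I_m.+1 -> bool}
     | is_state (zip w s.1) s.2].

Section Weights.
Variable F : fieldType.

Definition qint (q : F) (r : int) : F := (q ^ r - q ^ (- r)) / (q - q^-1).

(* The value 0 is never used: strands of the same sign do not cross. *)
Definition crossing_scalar (q : F) (r : int) (c alpha beta : bool) : F :=
  match c, alpha, beta with
  | false, true, true => q
  | false, false, false => - q^-1
  | false, false, true => q ^ r / qint q r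
  | false, true, false => - q ^ (- r) / qint q r
  | true, false, true => qint q (r + 1) / qint q r
  | true, true, false => qint q (r - 1) / qint q r
  | true, _, _ => 0
  end.

Fixpoint weight (m : nat) (v : F) (d : resolved m)
    (eps : {ffun 'I_m.+1 -> bool}) : F :=
  if d is (l, c) :: d' then
    crossing_scalar (if l.2 then v else v^-1) (nat_of_ord l.1).+1%:Z c
      (eps (strand d' (lpos l))) (eps (strand d' (rpos l)))
    * weight v d' eps
  else 1.

Definition sign_prod (m : nat) (eps : {ffun 'I_m.+1 -> bool}) : F :=
  \prod_j (if eps j then 1 else -1).

Definition state_sum (v : F) (m : nat) (w : seq (letter m)) : F :=
  (qint v m.+1%:Z)^-1
  * \sum_(s in states w) sign_prod s.2 * weight v (zip w s.1) s.2.

End Weights.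

(* Main.v *)
Require Import Defs.
From Stdlib Require Import Relations.
From mathcomp Require Import all_boot all_order all_algebra all_fingroup.
From mathcomp Require Import reals complex.
From mathcomp Require Import zify ring.

Set Implicit Arguments.
Unset Strict Implicit.
Unset Printing Implicit Defensive.

Import GRing.Theory.
Local Open Scope ring_scope.

(** The state sum is, up to the factor 1/[n], a trace.  Read as a matrix acting
    on sign sequences of length n, each letter acts by Young's seminormal form
    of the Hecke algebra on a hook-shaped representation: a sequence of signs
    records a standard tableau of hook shape, + adding a box to the arm and - a
    box to the leg; the first sign is +, for the corner box, and the axial
    distance between the boxes r and r+1, when one lies in the arm and the other
    in the leg, is always r.  This is why the scalars depend on r and on two
    signs only.  A resolution of the word together with the signs
    at its bottom is a path contributing to a matrix entry, and the states are
    exactly the paths of nonzero weight that return to their initial sequence: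
    equal signs never cross, so a returning path has the identity permutation
    [strand_trivial], and [0] = 0 forbids the first strand to move
    [weight_first_straight].  Hence the state sum is an alternating sum of
    hook characters divided by [n] [state_sum_hook_trace].

    It follows that the state sum is invariant under the braid relations
    [act_cancel], [act_far], [act_braid] and under conjugation
    [hook_trace_conj], that it satisfies the skein relation [act_skein], and,
    after summing over the last sign, that it is invariant under stabilization
    [hook_trace_stab].  A Conway-normalized Alexander polynomial, restricted
    to braid closures, has the same properties [markov_conway]; here the moves
    on diagrams have to be produced, and the one with some content is
    conjugation, for which a crossing is carried along the closing arcs
    ([slide_round_cups], [slide_round_caps]).

    Finally these properties determine a function on braid words
    [markov_trace_poly]: modulo the skein and braid relations every word
    reduces to words with at most one occurrence of the last generator
    [span_few]; if it occurs once, conjugation and stabilization remove it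
    together with a strand, and if it does not occur the closure is split and
    the value is zero.  All coefficients in this reduction are integral
    polynomials in z = v - v^-1, which gives both the equality of the two
    functions and the fact that their common value is a polynomial in z. *)

(** * Markov traces *)

Definition embed m (l : letter m) : letter m.+1 := (widen_ord (leqnSn m) l.1, l.2).

(** What remains of a Conway-normalized link invariant when only closures of
    braids are considered: by Markov's theorem conjugation and the two
    stabilizations generate all isotopies between them. *)
Record markov_trace (F : fieldType) (z : F) (f : forall m, seq (letter m) -> F)
    : Prop := MarkovTrace {
  mt_skein : forall m (u t : seq (letter m)) i,
    f m (u ++ (i, true) :: t) - f m (u ++ (i, false) :: t) = z * f m (u ++ t);
  mt_cancel : forall m (u t : seq (letter m)) i b,
    f m (u ++ [:: (i, b), (i, ~~ b) & t]) = f m (u ++ t);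
  mt_far : forall m (u t : seq (letter m)) (i j : 'I_m) b c, (i.+1 < j)%N ->
    f m (u ++ [:: (i, b), (j, c) & t]) = f m (u ++ [:: (j, c), (i, b) & t]);
  mt_braid : forall m (u t : seq (letter m)) (i j : 'I_m) b, j = i.+1 :> nat ->
    f m (u ++ [:: (i, b), (j, b), (i, b) & t])
    = f m (u ++ [:: (j, b), (i, b), (j, b) & t]);
  mt_conj : forall m (u t : seq (letter m)), f m (u ++ t) = f m (t ++ u);
  mt_stab : forall m (w : seq (letter m)) b,
    f m.+1 ((ord_max, b) :: map (@embed m) w) = f m w;
  mt_unit : f 0 [::] = 1 }.

Section Span.
Variable m : nat.
Implicit Types (Q : seq (letter m) -> Prop) (u t x y : seq (letter m)).

(** The properties of words that pass to linear combinations modulo the skein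
    and braid relations.  Quantifying over such predicates replaces the Hecke
    algebra: Q stands for the words whose class lies in a given submodule. *)
Record skein_closed Q : Prop := SkeinClosed {
  sc_skein : forall u t i b,
    Q (u ++ (i, b) :: t) -> Q (u ++ t) -> Q (u ++ (i, ~~ b) :: t);
  sc_insert : forall u t i b, Q (u ++ t) -> Q (u ++ [:: (i, b), (i, ~~ b) & t]);
  sc_far : forall u t (i j : 'I_m) b c, (i.+1 < j)%N ->
    Q (u ++ [:: (i, b), (j, c) & t]) <-> Q (u ++ [:: (j, c), (i, b) & t]);
  sc_braid : forall u t (i j : 'I_m) b, j = i.+1 :> nat ->
    Q (u ++ [:: (i, b), (j, b), (i, b) & t])
    -> Q (u ++ [:: (j, b), (i, b), (j, b) & t]) }.

(** Contexts play the part of left and right multiplication; this is what lets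
    the induction in [span_few] reduce a factor inside a longer word. *)
Lemma skein_closed_context Q u t :
  skein_closed Q -> skein_closed (fun x => Q (u ++ x ++ t)).
Proof.
move=> [h1 h2 h3 h4]; split=> u' t' i.
- by move=> b; rewrite -!catA !(catA u) /=; apply: h1.
- by move=> b; rewrite -!catA !(catA u) /=; apply: h2.
- by move=> j b c; rewrite -!catA !(catA u) /=; apply: h3.
- by move=> j b; rewrite -!catA !(catA u) /=; apply: h4.
Qed.

Definition below k x := all (fun l : letter m => (l.1 < k)%N) x.
Definition occ k x := count (fun l : letter m => l.1 == k :> nat) x.

Lemma sc_far_word Q u t x (j : 'I_m) c : skein_closed Q -> below j.-1 x ->
  Q (u ++ (j, c) :: x ++ t) <-> Q (u ++ x ++ (j, c) :: t).
Proof.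
move=> hQ; elim: x u => [|[i b] x IH] u //= /andP[ij xj].
have ij' : (i.+1 < j)%N by move: ij => /=; lia.
have -> : (u ++ (i, b) :: x ++ (j, c) :: t)
  = ((u ++ [:: (i, b)]) ++ x ++ (j, c) :: t) by rewrite -catA.
rewrite -IH // -catA /=.
by symmetry; apply: (sc_far hQ).
Qed.

Lemma below_occ0 k x : below k.+1 x -> occ k x = 0%N -> below k x.
Proof.
move=> xk /eqP; rewrite eqn0Ngt -has_count => /hasPn nk.
by apply/allP=> l lx; move: (allP xk l lx) (nk l lx) => /=; lia.
Qed.

Lemma below_split k x : below k.+1 x -> (0 < occ k x)%N ->
  exists y l t, [/\ x = y ++ l :: t, below k y, below k.+1 t & l.1 = k :> nat]
    /\ occ k x = (occ k t).+1.
Proof.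
elim: x => // l x IH /= /andP[lk xk].
have [e _|ne] := eqVneq (l.1 : nat) k.
  by exists [::], l, x; rewrite e add1n.
rewrite /= add0n => /(IH xk) [y [l' [t [[-> yk tk l'k] occE]]]].
exists (l :: y), l', t; split; last by rewrite /= occE ?add0n.
by split=> //=; rewrite yk andbT; move: lk ne; rewrite /=; lia.
Qed.

(** The quadratic relation s^2 = 1 + z s, for all choices of the signs. *)
Lemma sc_square Q u t (i : 'I_m) a b : skein_closed Q ->
  Q (u ++ t) -> Q (u ++ (i, a) :: t) -> Q (u ++ [:: (i, a), (i, b) & t]).
Proof.
move=> hQ h0 h1.
have hin := sc_insert hQ i a h0.
have [->//|e] := eqVneq b (~~ a).
have {e} -> : b = ~~ ~~ a by move: e; case: a {h1 hin}; case: b.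
have:= sc_skein hQ (u := u ++ [:: (i, a)]) (t := t) (i := i) (b := ~~ a).
by rewrite -!catA /=; apply.
Qed.

Lemma sc_switch Q u t (i : 'I_m) a b : skein_closed Q ->
  Q (u ++ t) -> Q (u ++ (i, a) :: t) -> Q (u ++ (i, b) :: t).
Proof.
move=> hQ h0 h1; have [->//|e] := eqVneq b a.
have -> : b = ~~ a by move: e; case: (a); case: b.
exact: (sc_skein hQ).
Qed.

Lemma below_cat k x y : below k (x ++ y) = below k x && below k y.
Proof. exact: all_cat. Qed.

Lemma occ_cat k x y : occ k (x ++ y) = (occ k x + occ k y)%N.
Proof. exact: count_cat. Qed.

Lemma below_le k k' x : (k <= k')%N -> below k x -> below k' x.
Proof. by move=> kk' /allP xk; apply/allP=> l /xk /= lk; apply: leq_trans kk'. Qed.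

Lemma occ_below k x : below k x -> occ k x = 0%N.
Proof.
move=> xk; apply/eqP; rewrite eqn0Ngt -has_count; apply/hasPn=> l /(allP xk) /=.
by lia.
Qed.

(** The Hecke algebra H_(k+1) is spanned by H_k and H_k s_k H_k.  Between two
    consecutive letters s_k stands a word of H_k, which by induction on k contains
    at most one letter s_(k-1).  If it contains none, both letters s_k can be
    brought together and merged by the quadratic relation; if it contains one,
    the three letters can be brought together, made positive, and
    s_k s_(k-1) s_k = s_(k-1) s_k s_(k-1) has one letter s_k less. *)
Lemma span_few k Q : skein_closed Q ->
  (forall y, below k y -> (occ k.-1 y <= 1)%N -> Q y) ->
  forall x, below k x -> Q x.
Proof.
elim: k Q => [|k IHk] Q hQ hfew x; first by case: x => // _; apply: hfew.
have [n] := ubnP (occ k x); elim: n x => // n IHn x xn xk.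
have [few|many] := leqP (occ k x) 1; first exact: hfew.
have [u [[i a] [s [[/= xE uk sk ik] occE]]]] := below_split xk (ltnW many).
rewrite occE ltnS in many.
have [y [[j b] [t [[/= sE yk tk jk] occsE]]]] := below_split sk many.
have ji : j = i by apply: val_inj; rewrite /= jk ik.
subst j => {jk}; subst s x; have i' : (i < k.+1)%N by rewrite ik.
have lowQ v : below k.+1 v -> (occ k v <= (occ k t).+1)%N -> Q v.
  by move=> vk ov; apply: IHn => //; move: xn; rewrite ltnS occE occsE; apply: leq_trans.
have occu := occ_below uk; have uk1 := below_le (leqnSn k) uk.
have ekk : (i == k :> nat) by apply/eqP.
(* No letter k-1 in between: the second top letter commutes with the word
   between them. *)
have adj v c : below k.-1 v -> Q (u ++ [:: (i, a) & v ++ (i, c) :: t]).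
  move=> vk1; have vk : below k v by exact: below_le (leq_pred k) vk1.
  have vk' := below_le (leqnSn k) vk; have ov := occ_below vk.
  rewrite -ik in vk1.
  have -> : u ++ (i, a) :: v ++ (i, c) :: t
    = (u ++ [:: (i, a)]) ++ v ++ (i, c) :: t by rewrite -catA.
  rewrite -(sc_far_word (u ++ [:: (i, a)]) t c hQ vk1) -catA /=.
  apply: sc_square => //; apply: lowQ;
    by rewrite ?below_cat ?occ_cat /= ?below_cat ?occ_cat ?uk1 ?vk' ?occu ?ov
      ?i' ?tk ?ekk.
pose Q' v := Q ((u ++ [:: (i, a)]) ++ v ++ (i, b) :: t).
have hQ' : skein_closed Q' by apply: skein_closed_context.
suff: Q' y by rewrite /Q' -catA.
apply: (IHk Q' hQ') => // {yk many occE xn sk xk occsE} y yk.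
rewrite /Q' -catA /= leq_eqVlt ltnS leqn0 orbC => /orP[/eqP o0|/eqP o1].
  apply: adj; case: (k) yk o0 => [|k']; first by case: y.
  exact: below_occ0.
have [k' kE] : exists k', k = k'.+1.
  by case: (k) yk o1 => [|k' _ _]; [case: y | exists k'].
rewrite kE /= in yk o1.
have [y1 [[j c] [y2 [[/= yE y1k y2k1 jk] occE]]]] := below_split yk (eq_leq (esym o1)).
have {occE} y2k : below k' y2.
  by apply: below_occ0 y2k1 _; move: occE; rewrite o1 => -[].
rewrite {}yE; have ij : i = j.+1 :> nat by rewrite ik jk.
have ekj : (j == k :> nat) = false by lia.
have jk1 : (j < k.+1)%N by lia.
have below1 v : below k' v -> below k.+1 v by apply: below_le; lia.
have occ1 v : below k' v -> occ k v = 0%N.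
  by move=> vk; apply: occ_below; apply: below_le vk; lia.
(* One letter k-1 in between: gather the three letters in the middle. *)
rewrite -catA /= (sc_far_word u _ a hQ); last by rewrite ik kE.
pose T := y2 ++ t; pose U := u ++ y1.
have -> : u ++ y1 ++ (i, a) :: (j, c) :: y2 ++ (i, b) :: t
  = (U ++ [:: (i, a); (j, c)]) ++ y2 ++ (i, b) :: t by rewrite /U -!catA.
rewrite -(sc_far_word _ t b hQ); last by rewrite ik kE.
rewrite -catA /= -/T.
have Uk : below k.+1 U by rewrite below_cat uk1 below1.
have Tk : below k.+1 T by rewrite below_cat tk below1.
have oU : occ k U = 0%N by rewrite occ_cat occu occ1.
have oT : occ k T = occ k t by rewrite occ_cat occ1.
clearbody U T; have few v : below k.+1 v -> (occ k v <= 1)%N -> Q (U ++ v ++ T).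
  move=> vk ov; apply: lowQ; first by rewrite !below_cat Uk Tk vk.
  by rewrite !occ_cat oU oT add0n -add1n leq_add2r.
(* Each change of sign costs the word without that letter, which has at most
   one top letter, or the square of the top letter. *)
have fewE := (i', jk1, ekk, ekj).
apply: (sc_switch (a := true)) => //.
  by apply: (few [:: (j, c); (i, b)]); rewrite /= ?fewE.
have -> : U ++ [:: (i, true), (j, c), (i, b) & T]
  = (U ++ [:: (i, true); (j, c)]) ++ (i, b) :: T by rewrite -catA.
apply: (sc_switch (a := true)) => //; rewrite -catA.
  by apply: (few [:: (i, true); (j, c)]); rewrite /= ?fewE.
have -> : U ++ [:: (i, true); (j, c)] ++ (i, true) :: T
  = (U ++ [:: (i, true)]) ++ (j, c) :: (i, true) :: T by rewrite -catA.
apply: (sc_switch (a := true)) => //; rewrite -catA /=.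
  apply: sc_square => //; first by apply: (few [::]).
  by apply: (few [:: (i, true)]); rewrite /= ?fewE.
apply: (sc_braid hQ) => //.
by apply: (few [:: (j, true); (i, true); (j, true)]); rewrite /= ?fewE.
Qed.
End Span.

Section MarkovUniqueness.
Variables (F : fieldType) (z : F).
Hypothesis z_neq0 : z != 0.

(** The polynomial p is chosen before the function f: it serves all Markov
    traces at once, and so proves them equal. *)
Definition evaluable m (w : seq (letter m)) (p : {poly int}) :=
  forall f, markov_trace z f -> f m w = (map_poly intr p).[z].

Lemma skein_closed_evaluable m :
  skein_closed (fun w : seq (letter m) => exists p, evaluable w p).
Proof.
split.
- move=> u t i b [p hp] [q hq].
  exists (p - (-1) ^+ (~~ b) *: ('X * q)) => f hf.
  rewrite rmorphB /= linearZ /= rmorphM /= map_polyX !hornerE -(hp f hf) -(hq f hf).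
  have := mt_skein hf u t i.
  rewrite rmorphXn rmorphN rmorph1.
  by case: b {hp} => /= /eqP; rewrite subr_eq => /eqP ->; ring.
- by move=> u t i b [p hp]; exists p => f hf; rewrite (mt_cancel hf) hp.
- move=> u t i j b c ij; split=> -[p hp]; exists p => f hf.
  + by rewrite -(mt_far hf) // hp.
  + by rewrite (mt_far hf) // hp.
- by move=> u t i j b ij [p hp]; exists p => f hf; rewrite -(mt_braid hf) // hp.
Qed.

(** A split closure: both stabilizations of the same word have the same value,
    so the skein relation gives z f(w) = 0. *)
Lemma markov_trace_embed0 f m (w : seq (letter m)) :
  markov_trace z f -> f m.+1 (map (@embed m) w) = 0.
Proof.
move=> hf; apply: (mulfI z_neq0); rewrite mulr0.
by rewrite -(mt_skein hf [::] _ ord_max) /= !(mt_stab hf) subrr.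
Qed.

Lemma below_embed m (x : seq (letter m.+1)) :
  below m x -> exists w, x = map (@embed m) w.
Proof.
elim: x => [|[i b] x IH] /=; first by exists [::].
move=> /andP[im /IH[w ->]]; exists ((Ordinal im, b) :: w) => /=.
by congr ((_, _) :: _); apply: val_inj.
Qed.

(** A word with one top letter is conjugate to a stabilization of a word on one
    strand less; a word without it is worth zero. *)
Theorem markov_trace_poly m (w : seq (letter m)) : exists p, evaluable w p.
Proof.
elim: m w => [|m IH] w.
  case: w => [|[[]]//]; exists 1 => f hf.
  by rewrite (mt_unit hf) rmorph1 hornerC.
apply: (span_few (k := m.+1) (skein_closed_evaluable m.+1)); last first.
  by apply/allP=> l _ /=.
move=> {}w wm /=; rewrite leq_eqVlt ltnS leqn0 orbC => /orP[/eqP o0|/eqP o1].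
  have [w' ->] := below_embed (below_occ0 wm o0).
  by exists 0 => f hf; rewrite markov_trace_embed0 // rmorph0 horner0.
have [u [[i b] [t [[/= wE um tm1 im] occE]]]] := below_split wm (eq_leq (esym o1)).
have tm : below m t by apply: below_occ0 tm1 _; move: occE; rewrite o1 => -[].
rewrite {}wE; have -> : i = ord_max by apply: val_inj.
have [u' ->] := below_embed um; have [t' ->] := below_embed tm.
have [p hp] := IH (t' ++ u'); exists p => f hf.
by rewrite (mt_conj hf) /= -map_cat (mt_stab hf) hp.
Qed.
End MarkovUniqueness.

(** * Diagrams of braid closures *)

(** Isotopy of lists of slices, so that moves can be composed without carrying
    the proofs that the diagrams are closed. *)
Definition closed_isotopic (d e : seq slice) : Prop :=
  exists (hd : is_closed d) (he : is_closed e),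
    isotopic (LinkDiagram hd) (LinkDiagram he).

Lemma closed_isotopic_refl d : is_closed d -> closed_isotopic d d.
Proof. by move=> hd; exists hd, hd; apply: rst_refl. Qed.

Lemma closed_isotopic_sym d e : closed_isotopic d e -> closed_isotopic e d.
Proof. by move=> [hd [he de]]; exists he, hd; apply: rst_sym. Qed.

Lemma closed_isotopic_trans d e f :
  closed_isotopic d e -> closed_isotopic e f -> closed_isotopic d f.
Proof.
move=> [hd [he de]] [he' [hf ef]]; exists hd, hf; apply: rst_trans de _.
by rewrite (bool_irrelevance he he').
Qed.

Lemma closed_isotopic_move u a b t : local_move a b ->
  is_closed (u ++ a ++ t) -> is_closed (u ++ b ++ t) ->
  closed_isotopic (u ++ a ++ t) (u ++ b ++ t).
Proof. by move=> ab hd he; exists hd, he; apply: rst_step; apply: Move ab _ _. Qed.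

(** Moves that are possible in every closed diagram containing them.  The moves
    R1, R2 and the zigzags are not of this kind when read from right to left,
    since the strands that they need may be missing or badly oriented.  For the
    others both sides have the same effect on every boundary, including whether
    they are defined; with this condition the relation is a congruence. *)
Definition slide (a b : seq slice) : Prop :=
  run a =1 run b /\
  forall u t, is_closed (u ++ a ++ t) -> closed_isotopic (u ++ a ++ t) (u ++ b ++ t).

Lemma run_context a b u t s : run a =1 run b -> run (u ++ a ++ t) s = run (u ++ b ++ t) s.
Proof.
move=> ab; rewrite !run_cat; case: (run u s) => //= r.
by rewrite !run_cat ab.
Qed.

Lemma slide_refl a : slide a a.
Proof. by split=> // u t; apply: closed_isotopic_refl. Qed.

Lemma slide_sym a b : slide a b -> slide b a.
Proof.
move=> [ab h]; split=> [s|u t hb]; first by rewrite ab.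
apply: closed_isotopic_sym; apply: h.
by rewrite /is_closed (run_context _ _ _ ab).
Qed.

Lemma slide_trans b a c : slide a b -> slide b c -> slide a c.
Proof.
move=> [ab h] [bc h']; split=> [s|u t ha]; first by rewrite ab.
apply: closed_isotopic_trans (h _ _ ha) _; apply: h'.
by rewrite /is_closed -(run_context _ _ _ ab).
Qed.

Lemma slide_context u t a b : slide a b -> slide (u ++ a ++ t) (u ++ b ++ t).
Proof.
move=> [ab h]; split=> [s|u' t']; first exact: run_context.
by rewrite -!catA !(catA u'); apply: h.
Qed.

Lemma slide_catl u a b : slide a b -> slide (u ++ a) (u ++ b).
Proof. by move/(slide_context u [::]); rewrite !cats0. Qed.

Lemma slide_catr t a b : slide a b -> slide (a ++ t) (b ++ t).
Proof. exact: (slide_context [::]). Qed.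

Lemma slide_closed a b : slide a b -> is_closed a -> closed_isotopic a b.
Proof. by move=> [_ h]; have := h [::] [::]; rewrite /= !cats0. Qed.

Lemma slide_move a b : local_move a b -> run a =1 run b -> slide a b.
Proof.
move=> ab e; split=> // u t ha; apply: closed_isotopic_move => //.
by rewrite /is_closed -(run_context _ _ _ e).
Qed.

Lemma slice_step_cat p i g s :
  slice_step ((size p + i)%N, g) (p ++ s)
  = omap (cat p) (slice_step (i, g) s).
Proof.
rewrite /slice_step size_cat leq_add2l; case: leqP => //= _.
rewrite take_cat drop_cat ltnNge leq_addr /= addKn.
by case: g => [o||b]; case: (drop i s) => [|x [|y r]] //=;
  rewrite -?catA //; case: eqP; rewrite //= -catA.
Qed.

Lemma run_cons a d s : run (a :: d) s = obind (run d) (slice_step a s).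
Proof. by []. Qed.

Lemma run_shift d p s :
  run [seq ((size p + a.1)%N, a.2) | a <- d] (p ++ s) = omap (cat p) (run d s).
Proof.
elim: d s => [|[i g] d IH] s //; rewrite map_cons !run_cons slice_step_cat.
by case: slice_step => [r|] //=; apply: IH.
Qed.

(** Equality of two runs needs checking only at height 0, where it holds by
    computation.  An empty list is excluded because it is defined on
    boundaries with fewer than i strands. *)
Lemma run_shift_eq i d e : (forall s, run d s = run e s) ->
  ~~ nilp d -> ~~ nilp e ->
  forall s, run [seq ((i + a.1)%N, a.2) | a <- d] s
            = run [seq ((i + a.1)%N, a.2) | a <- e] s.
Proof.
move=> de d0 e0 s; case: (leqP i (size s)) => [si|si].
  have shiftE f : run [seq ((i + a.1)%N, a.2) | a <- f] s
      = omap (cat (take i s)) (run f (drop i s)).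
    by rewrite -run_shift size_takel // cat_take_drop.
  by rewrite !shiftE de.
have none f : ~~ nilp f -> run [seq ((i + a.1)%N, a.2) | a <- f] s = None.
  case: f => // -[j g] f _; rewrite map_cons run_cons /slice_step /=.
  by rewrite leqNgt (leq_trans si (leq_addr _ _)).
by rewrite (none d) // (none e).
Qed.

Lemma slide_cup_cross i o b :
  slide [:: (i, Cup o); (i.+1, Cross b)] [:: (i.+1, Cup o); (i, Cross (~~ b))].
Proof.
apply: slide_move; first exact: lm_slide_cup.
move=> s; have := @run_shift_eq i [:: (0%N, Cup o); (1%N, Cross b)]
  [:: (1%N, Cup o); (0%N, Cross (~~ b))].
by rewrite /= addn0 addn1; apply=> // -[|x r] //=; rewrite ?take0 ?drop0.
Qed.

Lemma slide_cross_cap i b :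
  slide [:: (i, Cross b); (i.+1, Cap)] [:: (i.+1, Cross (~~ b)); (i, Cap)].
Proof.
apply: slide_move; first exact: lm_slide_cap.
move=> s; have := @run_shift_eq i [:: (0%N, Cross b); (1%N, Cap)]
  [:: (1%N, Cross (~~ b)); (0%N, Cap)].
by rewrite /= addn0 addn1; apply=> // -[|x [|y [|y' r]]] //=; rewrite ?take0 ?drop0.
Qed.

Lemma slide_braid i b :
  slide [:: (i, Cross b); (i.+1, Cross b); (i, Cross b)]
        [:: (i.+1, Cross b); (i, Cross b); (i.+1, Cross b)].
Proof.
apply: slide_move; first exact: lm_R3.
move=> s; have := @run_shift_eq i [:: (0%N, Cross b); (1%N, Cross b); (0%N, Cross b)]
  [:: (1%N, Cross b); (0%N, Cross b); (1%N, Cross b)].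
by rewrite /= addn0 addn1; apply=> // -[|x [|y [|y' r]]] //=; rewrite ?take0 ?drop0.
Qed.

Lemma slide_far i k g h :
  slide [:: (i, g); ((i + nout g + k)%N, h)]
        [:: ((i + nin g + k)%N, h); (i, g)].
Proof.
apply: slide_move; first exact: lm_far.
move=> s; have := @run_shift_eq i [:: (0%N, g); ((nout g + k)%N, h)]
  [:: ((nin g + k)%N, h); (0%N, g)].
rewrite /map addn0 !addnA; apply=> // {}s.
have step2 x y r : slice_step ((2 + k)%N, h) [:: x, y & r]
  = omap (cat [:: x; y]) (slice_step (k, h) r) by exact: (slice_step_cat [:: x; y]).
have short r : (size r < 2)%N -> slice_step ((2 + k)%N, h) r = None.
  by move=> r2; rewrite /slice_step leqNgt (leq_trans r2 (leq_addr _ _)).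
have step0 r : slice_step (0%N, g) r
  = match g, r with
    | Cup o, _ => Some [:: o, ~~ o & r]
    | Cap, [:: x, y & r'] => if x != y then Some r' else None
    | Cross _, [:: x, y & r'] => Some [:: y, x & r']
    | _, _ => None
    end by rewrite /slice_step leq0n take0 drop0.
have bindS (f : seq bool -> option (seq bool)) r : obind f (Some r) = f r by [].
rewrite !run_cons step0; case: g step0 => [o||b] step0; rewrite /nin /nout ?add0n.
- rewrite bindS run_cons step2.
  by case: slice_step => [r|] //=; rewrite take0 drop0.
- case: s => [|x [|y r]]; rewrite ?(short [::]) ?(short [:: _]) //; rewrite step2.
  by case: ifP => xy; rewrite ?bindS ?run_cons; case: (slice_step (k, h) r) => [r'|] //=;
    rewrite xy.
- case: s => [|x [|y r]]; rewrite ?(short [::]) ?(short [:: _]) // step2 bindS run_cons step2.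
  by case: slice_step => [r'|] //=; rewrite take0 drop0.
Qed.

Definition cups j k := [seq (a, Cup true) | a <- iota j k].
Definition caps j k := [seq (a, Cap) | a <- rev (iota j k)].
Definition crossings m (w : seq (letter m)) :=
  [seq (nat_of_ord l.1, Cross l.2) | l <- w].

Lemma slide_past (T : eqType) (h : T -> slice) (s : seq T) x :
  {in s, forall a, slide [:: h a; x] [:: x; h a]} ->
  slide (map h s ++ [:: x]) (x :: map h s).
Proof.
elim: s => [|a s IH] hs; first exact: slide_refl.
apply: (@slide_trans (h a :: x :: map h s)).
  apply: (@slide_catl [:: h a]); apply: IH => c cs; apply: hs.
  by rewrite inE cs orbT.
apply: (slide_catr (map h s) (a := [:: h a; x]) (b := [:: x; h a])).
by apply: hs; rewrite mem_head.
Qed.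

(** [slide_far] with the three positions free, so that arithmetic decides them. *)
Lemma slide_apart i j p q g h :
  p = (i + nin g + j)%N -> q = (i + nout g + j)%N ->
  slide [:: (i, g); (q, h)] [:: (p, h); (i, g)].
Proof. by move=> -> ->; apply: slide_far. Qed.

Lemma slide_cups_left i j k b : (i.+1 < j)%N ->
  slide (cups j k ++ [:: (i, Cross b)]) ((i, Cross b) :: cups j k).
Proof.
move=> ij; apply: slide_past => a; rewrite mem_iota => /andP[ja _].
by apply: slide_sym; apply: (slide_apart (j := (a - i.+2)%N)) => /=; lia.
Qed.

Lemma slide_caps_left i j k b : (i.+1 < j)%N ->
  slide (caps j k ++ [:: (i, Cross b)]) ((i, Cross b) :: caps j k).
Proof.
move=> ij; apply: slide_past => a; rewrite mem_rev mem_iota => /andP[ja _].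
by apply: slide_sym; apply: (slide_apart (j := (a - i.+2)%N)) => /=; lia.
Qed.

(** The slice is to the right of the minima, so each of them, opened below it,
    pushes it by two positions. *)
Lemma slide_cups_right j k p b : (j <= p)%N ->
  slide ((p, Cross b) :: cups j k) (cups j k ++ [:: ((p + k.*2)%N, Cross b)]).
Proof.
elim: k j p => [|k IH] j p jp; first by rewrite addn0; apply: slide_refl.
apply: (@slide_trans ((j, Cup true) :: (p.+2, Cross b) :: cups j.+1 k)).
  apply: (slide_catr (cups j.+1 k) (a := [:: (p, Cross b); (j, Cup true)])
    (b := [:: (j, Cup true); (p.+2, Cross b)])).
  by apply: slide_sym; apply: (slide_apart (j := (p - j)%N)) => /=; lia.
rewrite doubleS addnS -addSn addnS -addSn.
by apply: (@slide_catl [:: (j, Cup true)]); apply: IH; lia.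
Qed.

Lemma caps_rcons j k : caps j k.+1 = rcons (caps j.+1 k) (j, Cap).
Proof. by rewrite /caps /= rev_cons map_rcons. Qed.

Lemma slide_caps_right j k p b : (j <= p)%N ->
  slide (caps j k ++ [:: (p, Cross b)]) (((p + k.*2)%N, Cross b) :: caps j k).
Proof.
elim: k j p => [|k IH] j p jp; first by rewrite addn0; apply: slide_refl.
rewrite caps_rcons -cats1 -catA /=.
apply: (@slide_trans (caps j.+1 k ++ [:: (p.+2, Cross b); (j, Cap)])).
  by apply: slide_catl; apply: (slide_apart (j := (p - j)%N)) => /=; lia.
rewrite doubleS addnS -addSn addnS -addSn -!cat_cons.
rewrite -[[:: _; (j, Cap)]]/([:: (p.+2, Cross b)] ++ [:: (j, Cap)]) catA.
by apply: slide_catr; apply: IH; lia.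
Qed.

(** Of n nested minima only the i-th and the (i+1)-st from outside meet the
    crossing.  It slides down past the inner ones, then along the two arcs from
    the left legs to the right legs, then up again on the right of the inner
    ones.  Each slide along an arc exchanges the two signs, so that they cancel. *)
Lemma slide_round_cups n i b : (i.+1 < n)%N ->
  slide (cups 0 n ++ [:: (i, Cross b)])
        (cups 0 n ++ [:: ((n.-1.*2 - i)%N, Cross b)]).
Proof.
move=> ltin; have [k ->] : exists k, n = (i + k.+2)%N by exists (n - i.+2)%N; lia.
have -> : cups 0 (i + k.+2)
  = cups 0 i ++ [:: (i, Cup true); (i.+1, Cup true)] ++ cups i.+2 k.
  by rewrite /cups iotaD map_cat.
rewrite -!catA; apply: slide_catl.
apply: slide_trans (slide_catl _ (slide_cups_left k b (ltnSn _))) _.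
have -> : ((i + k.+2).-1.*2 - i)%N = (i.+2 + k.*2)%N by lia.
apply: slide_trans (slide_catl _ (slide_cups_right k b (leqnn _))).
apply: (slide_catr (cups i.+2 k) (a := [:: _; _; _]) (b := [:: _; _; _])).
apply: (@slide_trans [:: (i, Cup true); (i, Cup true); (i.+1, Cross (~~ b))]).
  apply: (@slide_catl [:: _]); apply: slide_sym.
  by have := slide_cup_cross i true (~~ b); rewrite negbK.
apply: (@slide_trans [:: (i, Cup true); (i.+2, Cup true); (i.+1, Cross (~~ b))]).
  apply: (@slide_catr [:: _] [:: _; _] [:: _; _]); apply: slide_sym.
  by apply: (slide_apart (j := 0)) => /=; lia.
apply: (@slide_catl [:: _]); apply: slide_sym; exact: slide_cup_cross.
Qed.

(** The mirror image of [slide_round_cups]. *)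
Lemma slide_round_caps n i b : (i.+1 < n)%N ->
  slide ((i, Cross b) :: caps 0 n) (((n.-1.*2 - i)%N, Cross b) :: caps 0 n).
Proof.
move=> ltin; have [k ->] : exists k, n = (i + k.+2)%N by exists (n - i.+2)%N; lia.
have -> : caps 0 (i + k.+2)
  = caps i.+2 k ++ [:: (i.+1, Cap); (i, Cap)] ++ caps 0 i.
  rewrite {1}/caps iotaD rev_cat map_cat add0n -/(caps i k.+2).
  by rewrite !caps_rcons -!cats1 -!catA.
rewrite -!cat_cons !catA; apply: slide_catr.
have -> : ((i + k.+2).-1.*2 - i)%N = (i.+2 + k.*2)%N by lia.
apply: slide_trans (slide_catr _ (slide_sym (slide_caps_left k b (ltnSn _)))) _.
apply: slide_trans (slide_catr _ (slide_caps_right k b (leqnn _))).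
rewrite -!catA; apply: slide_catl => /=.
apply: (@slide_trans [:: (i.+1, Cross (~~ b)); (i, Cap); (i, Cap)]).
  by apply: (@slide_catr [:: _] [:: _; _] [:: _; _]); apply: slide_cross_cap.
apply: (@slide_trans [:: (i.+1, Cross (~~ b)); (i.+2, Cap); (i, Cap)]).
  by apply: (@slide_catl [:: _]); apply: (slide_apart (j := 0)) => /=; lia.
apply: (@slide_catr [:: _] [:: _; _] [:: _; _]).
by have := slide_cross_cap i.+1 (~~ b); rewrite negbK.
Qed.

Lemma closure_catE m (u t : seq (letter m)) :
  braid_closure_slices (u ++ t)
  = (cups 0 m.+1 ++ crossings (rev t)) ++ (crossings (rev u) ++ caps 0 m.+1).
Proof. by rewrite /braid_closure_slices rev_cat map_cat -!catA. Qed.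

Lemma closure_contextE m (u x t : seq (letter m)) :
  braid_closure_slices (u ++ x ++ t)
  = (cups 0 m.+1 ++ crossings (rev t)) ++ crossings (rev x)
    ++ (crossings (rev u) ++ caps 0 m.+1).
Proof. by rewrite catA closure_catE rev_cat /crossings map_cat -!catA. Qed.

(** The letter goes from one end of the braid to the other round the closing
    arcs: along the maxima to the downward strands, past all the other
    crossings, and along the minima back to the upward strands. *)
Lemma closure_rot m (l : letter m) w :
  closed_isotopic (braid_closure_slices (l :: w)) (braid_closure_slices (rcons w l)).
Proof.
apply: slide_closed (braid_closure_closed _).
case: l => i b; rewrite -cats1 closure_catE -cat1s closure_catE -!catA.
have hp : (i.+1 < m.+1)%N by exact: ltn_ord.
rewrite -[crossings (rev [:: _])]/[:: (nat_of_ord i, Cross b)].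
have up := slide_round_caps b hp; have down := slide_sym (slide_round_cups b hp).
rewrite [m.+1.-1]/= in up down; set q := (m.*2 - i)%N in up down.
apply: slide_trans (slide_catl _ (slide_catl _ up)) _.
have := slide_catr (crossings (rev w) ++ caps 0 m.+1) down; rewrite -!catA => {}down.
refine (slide_trans _ down); apply: slide_catl.
suff past : slide (crossings (rev w) ++ [:: (q, Cross b)])
    ((q, Cross b) :: crossings (rev w)).
  by have := slide_catr (caps 0 m.+1) past; rewrite -catA.
apply: slide_past => -[j c] _ /=; have hj := ltn_ord j.
by apply: (slide_apart (j := (q - j.+2)%N)) => /=; rewrite /q; lia.
Qed.

(** The innermost arc meets only the last crossing.  Its maximum comes down past
    the other crossings, which leaves a curl that R1 removes. *)
Lemma closure_stab m (w : seq (letter m)) b :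
  closed_isotopic (braid_closure_slices (rcons (map (@embed m) w) (ord_max, b)))
    (braid_closure_slices w).
Proof.
have hcl := braid_closure_closed (rcons (map (@embed m) w) (ord_max, b)).
have cupsE : cups 0 m.+2 = cups 0 m.+1 ++ [:: (m.+1, Cup true)].
  by rewrite /cups -(addn1 m.+1) iotaD map_cat.
have capsE : caps 0 m.+2 = (m.+1, Cap) :: caps 0 m.+1.
  by rewrite /caps -(addn1 m.+1) iotaD rev_cat map_cat.
have crE : crossings (rev (map (@embed m) w)) = crossings (rev w).
  by rewrite /crossings -map_rev -map_comp.
have h : slide (braid_closure_slices (rcons (map (@embed m) w) (ord_max, b)))
    (cups 0 m.+1 ++ [:: (m.+1, Cup true); (m, Cross b); (m.+1, Cap)]
     ++ (crossings (rev w) ++ caps 0 m.+1)).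
  rewrite -cats1 closure_catE crE cupsE capsE -!catA.
  rewrite -[crossings (rev [:: _])]/[:: (m, Cross b)]; apply: slide_catl.
  suff past : slide (crossings (rev w) ++ [:: (m.+1, Cap)])
      ((m.+1, Cap) :: crossings (rev w)).
    have := slide_context [:: (m.+1, Cup true); (m, Cross b)] (caps 0 m.+1) past.
    by rewrite -catA.
  apply: slide_past => -[j c] _ /=; have hj := ltn_ord j.
  by apply: (slide_apart (j := (m.+1 - j.+2)%N)) => /=; lia.
have curl := slide_closed h hcl; case: (curl) => _ [hc _].
refine (closed_isotopic_trans curl (closed_isotopic_move (lm_R1_r m true b) hc _)).
exact: braid_closure_closed.
Qed.

Section Conway.
Variables (R : realType) (Delta : link_diagram -> ratfun R).
Hypothesis Delta_conway : is_conway Delta.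

Lemma conway_closed_isotopic m m' (w : seq (letter m)) (w' : seq (letter m')) :
  closed_isotopic (braid_closure_slices w) (braid_closure_slices w') ->
  Delta (braid_closure w) = Delta (braid_closure w').
Proof.
case: Delta_conway => hiso _ _ [hd [he]] /hiso.
by rewrite (bool_irrelevance hd (braid_closure_closed w))
  (bool_irrelevance he (braid_closure_closed w')).
Qed.

Lemma conway_slide m (u x y t : seq (letter m)) :
  slide (crossings (rev x)) (crossings (rev y)) ->
  Delta (braid_closure (u ++ x ++ t)) = Delta (braid_closure (u ++ y ++ t)).
Proof.
move=> xy; apply: conway_closed_isotopic.
apply: slide_closed (braid_closure_closed _).
by rewrite !closure_contextE; apply: slide_context.
Qed.

Lemma markov_conway :
  markov_trace (vvar R - (vvar R)^-1) (fun m w => Delta (@braid_closure m w)).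
Proof.
split.
- move=> m u t i; case: Delta_conway => _ _; apply.
  have runE : run (cups 0 m.+1 ++ crossings (rev t)) [::] = Some (bdry m.+1).
    by rewrite run_cat (run_cups m.+1); apply: run_cross.
  exists (cups 0 m.+1 ++ crossings (rev t)), (nat_of_ord i),
    (crossings (rev u) ++ caps 0 m.+1), (bdry m.+1); split=> //.
  - exact: (closure_contextE u [:: (i, true)] t).
  - exact: (closure_contextE u [:: (i, false)] t).
  - exact: closure_catE.
  rewrite /bdry !nth_cat !size_nseq !nth_nseq.
  by rewrite (ltn_trans (ltn_ord i)) // ltnS (ltn_ord i).
- move=> m u t i b; apply: conway_closed_isotopic.
  have wordE := closure_contextE u [:: (i, b); (i, ~~ b)] t.
  have hc := braid_closure_closed (u ++ [:: (i, b); (i, ~~ b)] ++ t).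
  have hc' := braid_closure_closed (u ++ t).
  have := lm_R2 i (~~ b); rewrite negbK => R2.
  rewrite wordE in hc; rewrite closure_catE in hc' *.
  by have := closed_isotopic_move R2 hc hc'; rewrite -wordE.
- move=> m u t i j b c ij; apply: (conway_slide u (x := [:: _; _]) (y := [:: _; _])).
  by apply: slide_sym; apply: (slide_apart (j := (j - i.+2)%N)) => /=; lia.
- move=> m u t i j b ij.
  apply: (conway_slide u (x := [:: _; _; _]) (y := [:: _; _; _])) => /=.
  by rewrite ij; apply: slide_braid.
- move=> m u t; elim: u t => [|l u IH] t; first by rewrite cats0.
  rewrite /= (conway_closed_isotopic (closure_rot l (u ++ t))) -cats1 -catA IH.
  by rewrite -catA.
- move=> m w b; rewrite (conway_closed_isotopic (closure_rot _ _)).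
  exact/conway_closed_isotopic/closure_stab.
- case: Delta_conway => hiso hunk _; rewrite -(hunk true); congr Delta.
  by rewrite /braid_closure /unknot; congr LinkDiagram; apply: bool_irrelevance.
Qed.
End Conway.

(** * The scalars of the state sum *)

Section Scalars.
Variable F : fieldType.

(** What the scalars need of v: then no [r] with r > 0 vanishes. *)
Definition generic (q : F) := q != 0 /\ forall k, (0 < k)%N -> q ^+ k != 1.

Lemma generic_inv q : generic q -> generic q^-1.
Proof.
move=> [q0 qk]; split=> [|k k0]; first by rewrite invr_eq0.
by rewrite exprVn invr_eq1 qk.
Qed.

Lemma qint_inv (q : F) r : qint q^-1 r = qint q r.
Proof.
rewrite /qint !exprz_inv opprK invrK -[in LHS]opprB -[X in _ / X]opprB.
by rewrite invrN mulrNN.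
Qed.

Lemma qint0 (q : F) : qint q 0 = 0.
Proof. by rewrite /qint oppr0 subrr mul0r. Qed.

Section Generic.
Variable q : F.
Hypothesis q_generic : generic q.

Let q_neq0 : q != 0. Proof. by case: q_generic. Qed.

Lemma generic_sq k : (0 < k)%N -> (q ^+ k) ^+ 2 - 1 != 0.
Proof. by case: q_generic => _ h k0; rewrite subr_eq0 -exprM h // muln_gt0 k0. Qed.

Lemma generic_sq1 : q ^+ 2 - 1 != 0.
Proof. by have := @generic_sq 1 isT; rewrite expr1. Qed.

Lemma qintE k : (0 < k)%N ->
  qint q k%:Z = ((q ^+ k) ^+ 2 - 1) * q / (q ^+ k * (q ^+ 2 - 1)).
Proof.
move=> k0; rewrite /qint -!exprnP -exprnN.
have := generic_sq1; have := expf_neq0 k q_neq0.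
move: (q ^+ k) => X X0 q2; field.
by rewrite q_neq0 X0 q2.
Qed.

Lemma qint_neq0 k : (0 < k)%N -> qint q k%:Z != 0.
Proof.
move=> k0; rewrite qintE //; rewrite !mulf_neq0 ?invr_eq0 ?mulf_neq0 //;
  by rewrite ?generic_sq ?generic_sq1 ?expf_neq0.
Qed.

Lemma qint_pred k : qint q (k%:Z - 1)
  = ((q ^+ k) ^+ 2 - q ^+ 2) / (q ^+ k * (q ^+ 2 - 1)).
Proof.
have hq := generic_sq1; have X0 := expf_neq0 k q_neq0.
rewrite /qint opprB !expfzDr // exprN1 expr1z -!exprnP -exprnN.
by move: (q ^+ k) X0 => X X0; field; rewrite q_neq0 X0 hq.
Qed.

(** A function of the signs in three consecutive positions is acted upon by the
    letters at the first two and at the last two of them. *)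
Definition low_op (r : int) (Phi : bool -> bool -> bool -> F) a b c :=
  crossing_scalar q r false a b * Phi a b c + crossing_scalar q r true a b * Phi b a c.
Definition high_op (r : int) (Phi : bool -> bool -> bool -> F) a b c :=
  crossing_scalar q r false b c * Phi a b c + crossing_scalar q r true b c * Phi a c b.

(** The braid relation of the seminormal form reduces to eight identities
    between rational functions of q and q^k, one for each choice of three
    signs; it holds for every k > 0, including signs that cannot occur at k = 1
    when the first strand is +. *)
Lemma crossing_scalar_braid k Phi a b c : (0 < k)%N ->
  low_op k%:Z (high_op k.+1%:Z (low_op k%:Z Phi)) a b c
  = high_op k.+1%:Z (low_op k%:Z (high_op k.+1%:Z Phi)) a b c.
Proof.
move=> k0; have hX := generic_sq k0.
have hY : (q ^+ k * q) * (q ^+ k * q) - 1 != 0 by rewrite -exprSr -expr2 generic_sq.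
have hq := generic_sq1; have X0 := expf_neq0 k q_neq0.
have e1 : qint q (k%:Z + 1) = qint q k.+1%:Z by congr qint; lia.
have e2 : qint q (k.+1%:Z - 1) = qint q k%:Z by congr qint; lia.
have e3 : qint q (k.+1%:Z + 1) = qint q k.+2%:Z by congr qint; lia.
case: a; case: b; case: c; rewrite /low_op /high_op /crossing_scalar ?e1 ?e2 ?e3 ?qint_pred
  ?qintE // -?exprnP -?exprnN ?exprSr;
  move: (q ^+ k) hX hY X0 => X hX hY X0; field;
  by rewrite ?q_neq0 ?X0 ?hX ?hY ?hq.
Qed.

Lemma crossing_scalar_cancel k (Phi : bool -> bool -> F) a b : (0 < k)%N ->
  let op p (Phi : bool -> bool -> F) a b :=
    crossing_scalar p k%:Z false a b * Phi a b
    + crossing_scalar p k%:Z true a b * Phi b a in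
  op q^-1 (op q Phi) a b = Phi a b.
Proof.
move=> k0 /=; have hX := generic_sq k0; have X0 := expf_neq0 k q_neq0.
have hq := generic_sq1.
have e1 : qint q (k%:Z + 1) = qint q k.+1%:Z by congr qint; lia.
case: a; case: b; rewrite /crossing_scalar ?qint_inv ?invrK ?exprz_inv ?opprK ?e1 ?qint_pred
  ?qintE // -?exprnP -?exprnN ?exprSr;
  move: (q ^+ k) hX X0 => X hX X0; field;
  by rewrite ?q_neq0 ?X0 ?hX ?hq.
Qed.

Lemma crossing_scalar_skein k c a b : (0 < k)%N ->
  crossing_scalar q k%:Z c a b - crossing_scalar q^-1 k%:Z c a b
  = (q - q^-1) * (~~ c)%:R.
Proof.
move=> k0; have hX := generic_sq k0; have X0 := expf_neq0 k q_neq0.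
have hq := generic_sq1.
case: c; first by rewrite mulr0 /crossing_scalar !qint_inv; case: a; case: b;
  rewrite ?subrr.
rewrite mulr1 /crossing_scalar ?qint_inv ?invrK ?exprz_inv ?opprK qintE //;
  rewrite -?exprnP -?exprnN; move: (q ^+ k) hX X0 => X hX X0.
by case: a; case: b => //; field; rewrite ?q_neq0 ?X0 ?hX ?hq.
Qed.

(** Summing over the sign of the last strand, with the sign of that strand as
    a factor, gives a scalar that does not depend on the other sign: this is
    what makes the trace a Markov trace, and where the factor 1/[n] comes from. *)
Lemma crossing_scalar_stab k a : (0 < k)%N ->
  crossing_scalar q k%:Z false a true - crossing_scalar q k%:Z false a false
  = qint q k.+1%:Z / qint q k%:Z.
Proof.
move=> k0; have hX := generic_sq k0; have X0 := expf_neq0 k q_neq0.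
have hq := generic_sq1.
rewrite /crossing_scalar !qintE // -?exprnP -?exprnN [q ^+ k.+1]exprSr.
move: (q ^+ k) hX X0 => X hX X0.
by case: a; field; rewrite ?q_neq0 ?X0 ?hX ?hq.
Qed.
End Generic.
End Scalars.


(** * The hook representations and their trace *)

Section HookRepresentation.
Variables (F : fieldType) (v : F).
Hypothesis v_generic : generic v.

Local Notation signs m := {ffun 'I_m.+1 -> bool}.

Definition swap_signs m (i : 'I_m) (y : signs m) : signs m :=
  [ffun j => y (tperm (widen_ord (leqnSn m) i) (lift ord0 i) j)].

Definition lscalar m (l : letter m) c (y : signs m) : F :=
  crossing_scalar (if l.2 then v else v^-1) (nat_of_ord l.1).+1%:Z c
    (y (lpos l)) (y (rpos l)).

(** Functions of signs are transported from the top of a crossing to its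
    bottom: a word is a matrix whose rows are indexed by the signs at the top and
    whose columns by the signs at the bottom, acting on row vectors on the right.
    A word being read from the top down, its first letter acts first. *)
Definition act_letter m (l : letter m) (phi : signs m -> F) (y : signs m) : F :=
  lscalar l false y * phi y + lscalar l true y * phi (swap_signs l.1 y).

Fixpoint act_word m (w : seq (letter m)) (phi : signs m -> F) : signs m -> F :=
  if w is l :: w' then act_word w' (act_letter l phi) else phi.

Definition delta m (x y : signs m) : F := (x == y)%:R.

Definition sign m (x : signs m) : F := sign_prod F x.

(** Row x of the matrix of w is the image of [delta x].  The sum over the x with
    first sign + is the trace on an invariant subspace, by [act_word_first]. *)
Definition hook_trace m (w : seq (letter m)) : F :=
  \sum_(x : signs m | x ord0) sign x * act_word w (delta x) x.

Lemma swapK m (i : 'I_m) : involutive (swap_signs i).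
Proof. by move=> y; apply/ffunP=> j; rewrite !ffunE tpermK. Qed.

Lemma eq_act_letter m (l : letter m) phi psi :
  phi =1 psi -> act_letter l phi =1 act_letter l psi.
Proof. by move=> e y; rewrite /act_letter !e. Qed.

Lemma eq_act_word m (w : seq (letter m)) phi psi :
  phi =1 psi -> act_word w phi =1 act_word w psi.
Proof. by elim: w phi psi => //= l w IH phi psi e; apply/IH/eq_act_letter. Qed.

Lemma act_word_cat m (u t : seq (letter m)) phi :
  act_word (u ++ t) phi = act_word t (act_word u phi).
Proof. by elim: u phi => /=. Qed.

Lemma act_word_sum m (w : seq (letter m)) (I : finType) (c : I -> F) psi y :
  act_word w (fun y => \sum_x c x * psi x y) y = \sum_x c x * act_word w (psi x) y.
Proof.
elim: w psi y => //= l w IH psi y; rewrite -IH; apply: eq_act_word => {}y.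
rewrite /act_letter !mulr_sumr -big_split /=; apply: eq_bigr => x _; ring.
Qed.

Lemma act_word_linear m (w : seq (letter m)) a phi psi y :
  act_word w (fun y => phi y + a * psi y) y = act_word w phi y + a * act_word w psi y.
Proof.
elim: w phi psi y => //= l w IH phi psi y; rewrite -IH; apply: eq_act_word => {}y.
rewrite /act_letter; ring.
Qed.

Lemma delta_sum m (phi : signs m -> F) y : \sum_x phi x * delta x y = phi y.
Proof.
rewrite (bigD1 y) //= /delta eqxx mulr1 big1 ?addr0 // => x /negPf ->.
by rewrite mulr0.
Qed.

Lemma act_word_delta m (w : seq (letter m)) phi y :
  act_word w phi y = \sum_x phi x * act_word w (delta x) y.
Proof. by rewrite -act_word_sum; apply: eq_act_word => z; rewrite delta_sum. Qed.

Lemma lpos_lt_rpos m (l : letter m) : (lpos l < rpos l)%N.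
Proof. by rewrite /= /bump leq0n. Qed.

Lemma swapE m (l : letter m) (y : signs m) j :
  swap_signs l.1 y j = y (tperm (lpos l) (rpos l) j).
Proof. by rewrite ffunE. Qed.

Lemma lscalar_true_neq m (l : letter m) (y : signs m) :
  lscalar l true y != 0 -> y (lpos l) != y (rpos l).
Proof.
by rewrite /lscalar; case: (y _); case: (y _); rewrite /crossing_scalar ?eqxx.
Qed.

(** A + strand in leftmost position could only be crossed with weight
    [0]/[1] = 0. *)
Lemma lscalar_true_first m (l : letter m) (y : signs m) :
  y ord0 -> lscalar l true y != 0 -> lpos l != ord0.
Proof.
move=> y0; apply: contraNneq => l0.
have i0 : (l.1 : nat) = 0%N by have := congr1 (@nat_of_ord _) l0.
rewrite /lscalar l0 y0 i0 /crossing_scalar; case: (y _) => //.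
by rewrite subrr qint0 mul0r.
Qed.

Lemma swap_first m (l : letter m) (y : signs m) :
  lpos l != ord0 -> swap_signs l.1 y ord0 = y ord0.
Proof. by move=> l0; rewrite (swapE l) tpermD // neq_ltn ltn0Sn orbT. Qed.

Lemma sign_swap m (i : 'I_m) (y : signs m) : sign (swap_signs i y) = sign y.
Proof.
rewrite /sign /sign_prod.
rewrite (reindex_inj (@perm_inj _ (tperm (widen_ord (leqnSn m) i) (lift ord0 i)))) /=.
by apply: eq_bigr => j _; rewrite ffunE tpermK.
Qed.

(** The matrix of a word is block triangular for every property of the signs
    that transverse crossings of nonzero weight preserve from bottom to top. *)
Lemma act_word_vanish m (P : pred (signs m)) (w : seq (letter m)) phi :
  (forall l y, P y -> lscalar l true y != 0 -> P (swap_signs l.1 y)) ->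
  (forall y, P y -> phi y = 0) -> forall y, P y -> act_word w phi y = 0.
Proof.
move=> hP; elim: w phi => //= l w IH phi h y Py; apply: IH Py => {}y Py.
rewrite /act_letter h // mulr0 add0r.
have [->|nz] := eqVneq (lscalar l true y) 0; first by rewrite mul0r.
by rewrite h ?mulr0 //; apply: hP.
Qed.

Lemma act_word_first m (w : seq (letter m)) (x y : signs m) :
  y ord0 -> ~~ x ord0 -> act_word w (delta x) y = 0.
Proof.
move=> y0 x0; apply: (@act_word_vanish _ (fun y : signs m => y ord0)) => //.
  by move=> l {}y /= {}y0 nz; rewrite swap_first // (lscalar_true_first y0 nz).
move=> {}y /= {}y0; rewrite /delta; case: eqP => // xy.
by rewrite xy y0 in x0.
Qed.

Lemma act_word_sign m (w : seq (letter m)) (x y : signs m) :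
  sign x * act_word w (delta x) y = sign y * act_word w (delta x) y.
Proof.
have [->//|ne] := eqVneq (sign x) (sign y).
rewrite (@act_word_vanish _ (fun y => sign x != sign y)) ?mulr0 //.
  by move=> l z; rewrite sign_swap.
by move=> z; rewrite /delta; case: (x =P z) => // ->; rewrite eqxx.
Qed.

Lemma hook_trace_cat m (u t : seq (letter m)) :
  hook_trace (u ++ t) = \sum_(x : signs m | x ord0) \sum_(z : signs m | z ord0)
    sign x * (act_word u (delta x) z * act_word t (delta z) x).
Proof.
apply: eq_bigr => x x0; rewrite act_word_cat act_word_delta mulr_sumr.
rewrite [RHS]big_mkcond; apply: eq_bigr => z _.
by case: ifPn => // z0; rewrite (act_word_first _ x0 z0) !mulr0.
Qed.

(** A trace is invariant under cyclic permutation; the factor [sign] commutes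
    with all matrices since crossings only permute the signs. *)
Lemma hook_trace_conj m (u t : seq (letter m)) :
  hook_trace (u ++ t) = hook_trace (t ++ u).
Proof.
rewrite !hook_trace_cat exchange_big; apply: eq_bigr => z _; apply: eq_bigr => x _.
by rewrite mulrA act_word_sign -mulrA [in RHS]mulrC [in LHS]mulrC -!mulrA mulrCA.
Qed.

Lemma hook_trace_local m (u x y t : seq (letter m)) :
  (forall phi, act_word x phi =1 act_word y phi) ->
  hook_trace (u ++ x ++ t) = hook_trace (u ++ y ++ t).
Proof.
move=> xy; apply: eq_bigr => s _; congr (_ * _).
by rewrite !act_word_cat; apply: eq_act_word.
Qed.


Lemma generic_letter b : generic (if b then v else v^-1).
Proof. by case: b => //; apply: generic_inv. Qed.

Lemma swap_lpos m (l : letter m) (y : signs m) : swap_signs l.1 y (lpos l) = y (rpos l).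
Proof. by rewrite swapE tpermL. Qed.

Lemma swap_rpos m (l : letter m) (y : signs m) : swap_signs l.1 y (rpos l) = y (lpos l).
Proof. by rewrite swapE tpermR. Qed.

Lemma act_cancel m (i : 'I_m) b phi : act_letter (i, ~~ b) (act_letter (i, b) phi) =1 phi.
Proof.
move=> y; pose q := if b then v else v^-1.
have q_generic : generic q by apply: generic_letter.
have qV : (if ~~ b then v else v^-1) = q^-1 by rewrite /q; case: (b); rewrite ?invrK.
(* If both signs are equal then y' ignores the swap; the transverse scalar
   is zero in that case. *)
pose y' (a c : bool) : signs m := if (a == y (lpos (i, b))) then y else swap_signs i y.
have [ll rr] := (swap_lpos (i, b) y, swap_rpos (i, b) y).
have := @crossing_scalar_cancel _ q q_generic i.+1 (fun a c => phi (y' a c))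
  (y (lpos (i, b))) (y (rpos (i, b))) isT.
rewrite /= /y' eqxx => <-; rewrite /act_letter /lscalar /= qV -/q swapK.
rewrite -[lpos (i, ~~ b)]/(lpos (i, b)) -[rpos (i, ~~ b)]/(rpos (i, b)) ll rr.
case: (y (lpos _)); case: (y (rpos _)) => //=; rewrite /crossing_scalar ?mul0r //.
Qed.

Lemma act_skein m (i : 'I_m) phi y :
  act_letter (i, true) phi y = act_letter (i, false) phi y + (v - v^-1) * phi y.
Proof.
have L c : lscalar (i, true) c y = lscalar (i, false) c y + (v - v^-1) * (~~ c)%:R.
  apply/eqP; rewrite addrC -subr_eq; apply/eqP.
  exact: (@crossing_scalar_skein _ v v_generic i.+1).
by rewrite /act_letter !L /= mulr1 mulr0; ring.
Qed.

Lemma act_far m (i j : 'I_m) b c phi : (i.+1 < j)%N ->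
  act_letter (i, b) (act_letter (j, c) phi) =1 act_letter (j, c) (act_letter (i, b) phi).
Proof.
move=> ij y; rewrite /act_letter.
have fixes (k : 'I_m) (a : bool) (x : 'I_m.+1) z :
    x != lpos (k, a) -> x != rpos (k, a) -> swap_signs k z x = z x.
  by move=> xl xr; rewrite (swapE (k, a)) tpermD // eq_sym.
have ne (x y' : 'I_m.+1) : (x != y' :> nat) -> x != y' by [].
have E1 z a : lscalar (i, b) a (swap_signs j z) = lscalar (i, b) a z.
  by rewrite /lscalar !(fixes j c) //; apply: ne => /=; rewrite /bump /=; lia.
have E2 z a : lscalar (j, c) a (swap_signs i z) = lscalar (j, c) a z.
  by rewrite /lscalar !(fixes i b) //; apply: ne => /=; rewrite /bump /=; lia.
have E3 : swap_signs j (swap_signs i y) = swap_signs i (swap_signs j y).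
  have apart (x : 'I_m.+1) : (x == lpos (i, b)) || (x == rpos (i, b)) ->
      (x != lpos (j, c)) && (x != rpos (j, c)).
    by case/orP=> /eqP ->; apply/andP; split; apply: ne => /=; rewrite /bump /=; lia.
  have fixj (x : 'I_m.+1) : (x == lpos (i, b)) || (x == rpos (i, b)) ->
      tperm (lpos (j, c)) (rpos (j, c)) x = x.
    by move=> /apart/andP[xl xr]; rewrite tpermD // eq_sym.
  have fixi (x : 'I_m.+1) : ~~ ((x == lpos (i, b)) || (x == rpos (i, b))) ->
      tperm (lpos (i, b)) (rpos (i, b)) x = x.
    by rewrite negb_or => /andP[xl xr]; rewrite tpermD // eq_sym.
  apply/ffunP=> x; rewrite !(swapE (i, b)) !(swapE (j, c)) !(swapE (i, b)); congr (y _).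
  case: (boolP ((x == lpos (i, b)) || (x == rpos (i, b)))) => xi.
    rewrite (fixj x) // fixj //.
    by case/orP: xi => /eqP ->; rewrite ?tpermL ?tpermR eqxx ?orbT.
  rewrite (fixi x) // fixi //; apply: contra xi => xi.
  by have := fixj _ xi; rewrite tpermK => ->.
by rewrite -[(i, b).1]/i -[(j, c).1]/j !E1 !E2 E3; ring.
Qed.


(** The sequence y with a, b, c in the three consecutive positions that the
    generators i and j = i+1 act upon. *)
Definition upd m (i j : 'I_m) (y : signs m) a b c : signs m :=
  [ffun k => if k == lpos (i, true) then a else if k == lpos (j, true) then b
             else if k == rpos (j, true) then c else y k].

Lemma upd_id m (i j : 'I_m) (y : signs m) :
  upd i j y (y (lpos (i, true))) (y (lpos (j, true))) (y (rpos (j, true))) = y.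
Proof.
by apply/ffunP=> k; rewrite ffunE; do 3! [case: eqP => [->//|_]].
Qed.

Section Consecutive.
Variables (m : nat) (i j : 'I_m) (b : bool).
Hypothesis ij : j = i.+1 :> nat.

Let p := lpos (i, b).
Let q := lpos (j, b).
Let r := rpos (j, b).

Let rposE : rpos (i, b) = q.
Proof. by apply: val_inj; rewrite /= /bump /= ij. Qed.

Let distinct : [/\ p != q, p != r & q != r].
Proof. by split; rewrite -val_eqE /= /bump /=; lia. Qed.

Let updE y a c d : [/\ upd i j y a c d p = a, upd i j y a c d q = c
  & upd i j y a c d r = d].
Proof.
case: distinct => pq pr qr; rewrite !ffunE -[lpos (i, true)]/p -[lpos (j, true)]/q
  -[rpos (j, true)]/r !eqxx.
by rewrite [q == p]eq_sym (negPf pq) [r == p]eq_sym (negPf pr) [r == q]eq_sym (negPf qr).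
Qed.

Let updD y a c d k : k != p -> k != q -> k != r -> upd i j y a c d k = y k.
Proof.
move=> kp kq kr; rewrite ffunE -[lpos (i, true)]/p -[lpos (j, true)]/q.
by rewrite -[rpos (j, true)]/r (negPf kp) (negPf kq) (negPf kr).
Qed.

Let swap_low y a c d : swap_signs i (upd i j y a c d) = upd i j y c a d.
Proof.
case: distinct => pq pr qr; have [u1 u2 u3] := updE y a c d.
have [w1 w2 w3] := updE y c a d.
apply/ffunP=> k; rewrite (swapE (i, b)) rposE -/p; case: tpermP => [->|->|/eqP kp /eqP kq].
- by rewrite u2 w1.
- by rewrite u1 w2.
- by have [->|kr] := eqVneq k r; rewrite ?u3 ?w3 // !updD.
Qed.

Let swap_high y a c d : swap_signs j (upd i j y a c d) = upd i j y a d c.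
Proof.
case: distinct => pq pr qr; have [u1 u2 u3] := updE y a c d.
have [w1 w2 w3] := updE y a d c.
apply/ffunP=> k; rewrite (swapE (j, b)) -/q -/r; case: tpermP => [->|->|/eqP kq /eqP kr].
- by rewrite u3 w2.
- by rewrite u2 w3.
- by have [->|kp] := eqVneq k p; rewrite ?u1 ?w1 // !updD.
Qed.

Let low y psi a c d : act_letter (i, b) psi (upd i j y a c d)
  = low_op (if b then v else v^-1) i.+1%:Z (fun a c d => psi (upd i j y a c d)) a c d.
Proof.
have [u1 u2 u3] := updE y a c d.
by rewrite /act_letter /lscalar rposE -/p u1 u2 swap_low.
Qed.

Let high y psi a c d : act_letter (j, b) psi (upd i j y a c d)
  = high_op (if b then v else v^-1) i.+2%:Z (fun a c d => psi (upd i j y a c d)) a c d.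
Proof.
have [u1 u2 u3] := updE y a c d.
by rewrite /act_letter /lscalar -/q -/r u2 u3 swap_high -ij.
Qed.

Lemma act_braid phi :
  act_letter (i, b) (act_letter (j, b) (act_letter (i, b) phi))
  =1 act_letter (j, b) (act_letter (i, b) (act_letter (j, b) phi)).
Proof.
move=> y; rewrite -(upd_id i j y).
have := crossing_scalar_braid (generic_letter b)
  (fun a c d => phi (upd i j y a c d)) (y (lpos (i, true))) (y (lpos (j, true)))
  (y (rpos (j, true))) (ltn0Sn i).
rewrite low high /low_op /high_op !low !high /low_op /high_op !low !high.
by rewrite /low_op /high_op.
Qed.
End Consecutive.

Definition extend m (x : signs m) (e : bool) : signs m.+1 :=
  [ffun j => if unlift ord_max j is Some k then x k else e].

Lemma extend_max m (x : signs m) e : extend x e ord_max = e.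
Proof. by rewrite ffunE unlift_none. Qed.

Lemma extend_lift m (x : signs m) e j : extend x e (lift ord_max j) = x j.
Proof. by rewrite ffunE liftK. Qed.

Lemma lift_max_val n (j : 'I_n) : lift ord_max j = j :> nat.
Proof. by rewrite /= /bump leqNgt ltn_ord. Qed.

Lemma lpos_embed m (l : letter m) : lpos (embed l) = lift ord_max (lpos l).
Proof. by apply: ord_inj; rewrite lift_max_val. Qed.

Lemma rpos_embed m (l : letter m) : rpos (embed l) = lift ord_max (rpos l).
Proof. by apply: ord_inj; rewrite lift_max_val. Qed.

Lemma signs_eqP m (x y : signs m.+1) : x ord_max = y ord_max ->
  (forall j : 'I_m.+1, x (lift ord_max j) = y (lift ord_max j)) -> x = y.
Proof.
move=> e h; apply/ffunP=> k.
by case: (unliftP ord_max k) => [j ->|->].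
Qed.

Lemma swap_extend m (l : letter m) (x : signs m) e :
  swap_signs (embed l).1 (extend x e) = extend (swap_signs l.1 x) e.
Proof.
apply: signs_eqP => [|j]; rewrite swapE lpos_embed rpos_embed.
  by rewrite tpermD ?extend_max // eq_sym neq_lift.
rewrite !extend_lift swapE; case: tpermP => [/lift_inj->|/lift_inj->|jl jr].
- by rewrite extend_lift tpermL.
- by rewrite extend_lift tpermR.
- by rewrite tpermD ?extend_lift //; apply/eqP=> jj; [apply: jl | apply: jr]; rewrite jj.
Qed.

Lemma act_word_extend m (w : seq (letter m)) phi (y : signs m) e :
  act_word (map (@embed m) w) phi (extend y e) = act_word w (fun y => phi (extend y e)) y.
Proof.
elim: w phi y => //= l w IH phi y; rewrite IH; apply: eq_act_word => {}y.
by rewrite /act_letter /lscalar swap_extend lpos_embed rpos_embed !extend_lift.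
Qed.

(** A transverse crossing with the last strand changes the last sign, and the
    other letters of a stabilized word cannot restore it. *)
Lemma act_last_delta m b (x y : signs m) e :
  act_letter (ord_max, b) (delta (extend x e)) (extend y e)
  = crossing_scalar (if b then v else v^-1) m.+1%:Z false (x ord_max) e * delta x y.
Proof.
have lE : lpos (ord_max, b) = lift ord_max ord_max :> 'I_m.+2.
  by apply: ord_inj; rewrite lift_max_val.
have rE : rpos (ord_max, b) = ord_max :> 'I_m.+2 by apply: val_inj.
rewrite /act_letter /lscalar lE rE extend_lift extend_max /=.
have -> : delta (extend x e) (extend y e) = delta x y.
  rewrite /delta; congr (nat_of_bool _)%:R; apply/eqP/eqP => [h|->//].
  by apply/ffunP=> j; rewrite -(extend_lift x e) h extend_lift.
have -> z : crossing_scalar z m.+1%:Z true (y ord_max) e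
    * delta (extend x e) (swap_signs ord_max (extend y e)) = 0.
  rewrite /delta; case: eqP => [h|_]; last by rewrite mulr0.
  have := congr1 (fun u : signs m.+1 => u ord_max) h.
  rewrite (swapE (ord_max, b)) lE rE tpermR extend_lift extend_max => <-.
  by case: (e); rewrite /crossing_scalar mul0r.
rewrite addr0 /delta; case: eqP => [->//|_]; by rewrite !mulr0.
Qed.

Lemma sum_extend m (G : signs m.+1 -> F) :
  \sum_(x : signs m.+1 | x ord0) G x
  = \sum_(x : signs m | x ord0) (G (extend x true) + G (extend x false)).
Proof.
rewrite (reindex (fun p : signs m * bool => extend p.1 p.2)) /=; last first.
  exists (fun x : signs m.+1 => ([ffun j => x (lift ord_max j)], x ord_max)).
    move=> [x e] _ /=; congr (_, _); last exact: extend_max.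
    by apply/ffunP=> j; rewrite ffunE extend_lift.
  move=> x _; apply: signs_eqP => [|j]; first by rewrite extend_max.
  by rewrite extend_lift ffunE.
have first_extend (x : signs m) e : extend x e ord0 = x ord0.
  rewrite -(extend_lift x e); congr (extend _ _ _).
  by apply: ord_inj; rewrite lift_max_val.
rewrite (eq_bigl (fun p : signs m * bool => p.1 ord0 && true)); last first.
  by move=> [x e]; rewrite /= first_extend andbT.
rewrite -(pair_big (fun x : signs m => x ord0) xpredT (fun x e => G (extend x e))) /=.
by apply: eq_bigr => x _; rewrite big_bool.
Qed.

Lemma sign_extend m (x : signs m) e : sign (extend x e) = sign x * (if e then 1 else -1).
Proof.
rewrite /sign /sign_prod big_ord_recr /=.
rewrite extend_max; congr (_ * _); apply: eq_bigr => j _.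
rewrite -(extend_lift x e); congr (if extend _ _ _ then _ else _).
by apply: ord_inj; rewrite lift_max_val.
Qed.

Lemma hook_trace_stab m (w : seq (letter m)) b :
  hook_trace ((ord_max, b) :: map (@embed m) w)
  = qint v m.+2%:Z / qint v m.+1%:Z * hook_trace w.
Proof.
rewrite /hook_trace sum_extend mulr_sumr; apply: eq_bigr => x _ /=.
have E e : act_word [seq embed i | i <- w]
    (act_letter (ord_max, b) (delta (extend x e))) (extend x e)
  = crossing_scalar (if b then v else v^-1) m.+1%:Z false (x ord_max) e
    * act_word w (delta x) x.
  rewrite act_word_extend -[RHS]add0r -[0](@act_word_vanish _ xpredT w (fun=> 0) _ _ x) //.
  by rewrite -act_word_linear; apply: eq_act_word => y; rewrite add0r act_last_delta.
have := crossing_scalar_stab (generic_letter b) (x ord_max) (ltn0Sn m).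
have qE k : qint (if b then v else v^-1) k = qint v k by case: (b); rewrite ?qint_inv.
by rewrite !qE => <-; rewrite !E !sign_extend; ring.
Qed.

Lemma hook_trace_unit : hook_trace ([::] : seq (letter 0)) = 1.
Proof.
rewrite /hook_trace (big_pred1 [ffun=> true]) /=.
  by rewrite /delta eqxx mulr1 /sign /sign_prod big_ord1 ffunE.
move=> x; apply/idP/eqP => [x0|->]; last by rewrite ffunE.
by apply/ffunP=> j; rewrite ffunE (ord1 j).
Qed.

Lemma markov_hook_trace :
  markov_trace (v - v^-1)
    (fun m (w : seq (letter m)) => (qint v m.+1%:Z)^-1 * hook_trace w).
Proof.
have local m (u x y t : seq (letter m)) :
    (forall phi, act_word x phi =1 act_word y phi) ->
    (qint v m.+1%:Z)^-1 * hook_trace (u ++ x ++ t)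
    = (qint v m.+1%:Z)^-1 * hook_trace (u ++ y ++ t).
  by move=> xy; rewrite (hook_trace_local _ _ xy).
split.
- move=> m u t i; rewrite -mulrBr mulrCA; congr (_ * _).
  rewrite /hook_trace -sumrB mulr_sumr; apply: eq_bigr => x _.
  rewrite !act_word_cat /= (eq_act_word _ (act_skein i _)) act_word_linear; ring.
- move=> m u t i b; apply: (local _ _ [:: _; _] [::]) => phi y /=.
  by have := act_cancel i b phi y.
- move=> m u t i j b c ij; apply: (local _ _ [:: _; _] [:: _; _]) => phi y /=.
  by rewrite -act_far.
- move=> m u t i j b ij; apply: (local _ _ [:: _; _; _] [:: _; _; _]) => phi y /=.
  exact: act_braid.
- by move=> m u t; rewrite hook_trace_conj.
- move=> m w b; rewrite hook_trace_stab mulrA; congr (_ * _).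
  by rewrite mulrA mulVf ?mul1r // qint_neq0.
- have := qint_neq0 v_generic (ltn0Sn 0).
  rewrite hook_trace_unit mulr1 /qint expr1z exprN1 mulf_eq0 => /norP[d _].
  by rewrite divff // invr1.
Qed.
End HookRepresentation.

(** * The state sum as a trace *)

Section StateSum.
Variables (F : fieldType) (v : F).
Local Notation signs m := {ffun 'I_m.+1 -> bool}.

Definition top_signs m (d : resolved m) (eps : signs m) : signs m :=
  [ffun p => eps (strand d p)].

Lemma top_signs_nil m (eps : signs m) : top_signs [::] eps = eps.
Proof. by apply/ffunP=> p; rewrite ffunE perm1. Qed.

Lemma top_signs_cons m (l : letter m) c d eps :
  top_signs ((l, c) :: d) eps
  = if c then swap_signs l.1 (top_signs d eps) else top_signs d eps.
Proof.
by case: c; apply/ffunP=> p; rewrite ?(swapE l) !ffunE /= permM ?perm1.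
Qed.

Lemma weight_cons m (l : letter m) c d eps :
  weight v ((l, c) :: d) eps = lscalar v l c (top_signs d eps) * weight v d eps.
Proof. by rewrite /lscalar !ffunE. Qed.

(** Expanding a product of matrices: the paths are the resolutions. *)
Lemma sum_resolutions m (w : seq (letter m)) phi eps :
  \sum_(c : (size w).-tuple bool) phi (top_signs (zip w c) eps) * weight v (zip w c) eps
  = act_word v w phi eps.
Proof.
elim: w phi => [|l w IH] phi.
  rewrite (big_pred1 [tuple]) => [|c]; first by rewrite top_signs_nil mulr1.
  by rewrite [c]tuple0; apply/esym/eqP.
rewrite /= -IH (reindex (fun p : bool * (size w).-tuple bool => [tuple of p.1 :: p.2])) /=;
  last first.
  exists (fun c => (thead c, [tuple of behead c])) => [[a c] _|c _].
    by congr (_, _); apply: val_inj.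
  by rewrite [RHS]tuple_eta; apply: val_inj.
pose G a (c : (size w).-tuple bool) :=
  phi (top_signs ((l, a) :: zip w c) eps) * weight v ((l, a) :: zip w c) eps.
transitivity (\sum_a \sum_c G a c); first by rewrite pair_bigA.
rewrite exchange_big; apply: eq_bigr => c _.
rewrite big_bool /G !weight_cons !top_signs_cons /act_letter /=; ring.
Qed.

Section Rigidity.
Variables (m : nat) (eps : signs m).

Definition noncrossing (d : resolved m) :=
  all_crossings (fun a b => eps a != eps b) d.

(** Strands of equal signs do not cross, so they keep their order. *)
Lemma strand_monotone d : noncrossing d ->
  forall p q : 'I_m.+1, (p < q)%N -> eps (strand d p) = eps (strand d q) ->
  (strand d p < strand d q)%N.
Proof.
elim: d => [|[l [|]] d IH] /=; first by move=> _ p q; rewrite !perm1.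
  move=> /andP[ne nd] p q pq; rewrite !permM.
  move=> e; apply: IH => //; move: e.
  have lr := lpos_lt_rpos l; have rE : rpos l = (lpos l).+1 :> nat by rewrite /= /bump.
  case: tpermP => [pE|pE|/eqP pl /eqP pr]; case: tpermP => [qE|qE|/eqP ql /eqP qr];
    subst => // e; try lia.
  - by rewrite ltn_neqAle eq_sym (inj_eq val_inj) qr rE.
  - by rewrite ltn_neqAle (inj_eq val_inj) pl -ltnS -rE.
by move=> nd p q pq; rewrite mul1g; apply: IH.
Qed.

(** A permutation that preserves the signs and is increasing on each of the two
    sign classes is the identity: at the least p that is moved, p itself is the
    image of some q > p, in the same class, while the image of p exceeds p. *)
Lemma strand_trivial d : noncrossing d -> top_signs d eps = eps -> strand d = 1%g.
Proof.
move=> nd top; have topE p : eps (strand d p) = eps p by rewrite -[in RHS]top ffunE.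
apply/permP=> p; rewrite perm1; have [n] := ubnP (p : nat).
elim: n p => // n IH p pn; apply/eqP/negPn/negP => sp.
have lt_fix (q : 'I_m.+1) : (q < p)%N -> strand d q = q.
  by move=> qp; apply: IH; apply: leq_trans qp _; rewrite -ltnS.
have p_lt : (p < strand d p)%N.
  rewrite ltn_neqAle eq_sym sp leqNgt; apply/negP=> /[dup] /lt_fix /perm_inj e.
  by rewrite e ltnn.
pose q := (strand d)^-1%g p; have qE : strand d q = p by rewrite permKV.
have pq : (p < q)%N.
  rewrite ltn_neqAle leqNgt; apply/andP; split.
    by apply: contraNneq sp => /val_inj e; rewrite {1}e qE.
  by apply/negP=> /[dup] /lt_fix; rewrite qE => <-; rewrite ltnn.
have := strand_monotone nd pq; rewrite qE !topE -[in eps p]qE topE => /(_ erefl).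
by rewrite ltnNge ltnW.
Qed.

Lemma weight_noncrossing d : weight v d eps != 0 -> noncrossing d.
Proof.
elim: d => // -[l c] d IH; rewrite weight_cons mulf_eq0 negb_or => /andP[nz /IH nd].
rewrite /noncrossing /= -/(noncrossing d) nd andbT; apply/implyP=> cT.
by move: nz; rewrite cT => /lscalar_true_neq; rewrite !ffunE.
Qed.

(** As long as the first strand is in leftmost position, the crossing that would
    move it has it on its left, and [lscalar_true_first] applies. *)
Lemma weight_first_straight d : eps ord0 -> weight v d eps != 0 ->
  strand d ord0 = ord0 /\ all_crossings (fun a b => (a != ord0) && (b != ord0)) d.
Proof.
move=> e0; elim: d => [|[l c] d IH]; first by rewrite perm1.
rewrite weight_cons mulf_eq0 negb_or => /andP[nz /IH [d0 hd]].
case: c nz => [nz|_] /=; last by rewrite mul1g.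
have top0 : top_signs d eps ord0 by rewrite ffunE d0.
have l0 := lscalar_true_first top0 nz.
have r0 : rpos l != ord0 by rewrite -val_eqE.
have moved k : k != ord0 -> strand d k != ord0.
  by rewrite -[in X in _ -> X]d0 (inj_eq perm_inj).
by rewrite permM tpermD // d0 hd !moved.
Qed.
End Rigidity.

(** Among the resolutions of nonzero weight with first sign +, the states are
    those whose signs at the top are those at the bottom. *)
Lemma state_weight m (d : resolved m) (eps : signs m) : eps ord0 ->
  (if is_state d eps then weight v d eps else 0)
  = delta F eps (top_signs d eps) * weight v d eps.
Proof.
move=> e0; have [->|nz] := eqVneq (weight v d eps) 0; first by rewrite mulr0 if_same.
have nd := weight_noncrossing nz; have [_ first] := weight_first_straight e0 nz.
rewrite /is_state /admissible first e0 andbC -/(noncrossing eps d) nd /= /delta.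
have -> : (strand d == 1%g) = (eps == top_signs d eps).
  apply/eqP/eqP => [e|e]; last exact: strand_trivial nd (esym e).
  by apply/ffunP=> p; rewrite ffunE e perm1.
by case: eqP => _; rewrite ?mul1r ?mul0r.
Qed.

Lemma state_sum_hook_trace m (w : seq (letter m)) :
  state_sum v w = (qint v m.+1%:Z)^-1 * hook_trace v w.
Proof.
congr (_ * _); rewrite big_mkcond.
pose G (c : (size w).-tuple bool) (eps : signs m) :=
  if (c, eps) \in states w then sign F eps * weight v (zip w c) eps else 0.
transitivity (\sum_c \sum_eps G c eps).
  by rewrite pair_bigA; apply: eq_bigr => -[c eps] _.
rewrite exchange_big /hook_trace [RHS]big_mkcond; apply: eq_bigr => eps _; rewrite /G.
case: ifPn => e0; last first.
  by apply: big1 => c _; rewrite inE /is_state (negPf e0) andbF.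
rewrite -sum_resolutions mulr_sumr; apply: eq_bigr => c _.
rewrite inE -state_weight //=; case: ifP => _; by rewrite ?mulr0.
Qed.
End StateSum.

Lemma generic_vvar (R : realType) : generic (vvar R).
Proof.
split=> [|k k0]; rewrite /vvar.
  by rewrite tofrac_eq0 polyX_eq0.
rewrite -tofracXn -tofrac1 tofrac_eq; apply/eqP => /(congr1 (fun p : {poly _} => size p)).
by rewrite size_polyXn size_poly1; case: k k0.
Qed.

Theorem theorem3p1 (R : realType) (L : link_diagram) (m : nat)
    (w : seq (letter m)) (hL : isotopic (braid_closure w) L) :
  let v := vvar R in
  let A := state_sum v w in
  (exists p : {poly R[i]%C},
     A = (map_poly (fun c => tofrac c%:P) p).[v - v^-1]) /\
  (forall Delta : link_diagram -> ratfun R, is_conway Delta -> A = Delta L).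
Proof.
move=> v A; have v_generic := generic_vvar R.
have z_neq0 : v - v^-1 != 0.
  have := qint_neq0 v_generic (ltn0Sn 0).
  by rewrite /qint mulf_eq0 invr_eq0 => /norP[_].
have [p hp] := markov_trace_poly z_neq0 w.
have Ap : A = (map_poly intr p).[v - v^-1].
  by rewrite /A state_sum_hook_trace; apply: (hp _ (markov_hook_trace v_generic)).
split=> [|Delta hDelta].
  exists (map_poly intr p); rewrite Ap; congr _.[_]; apply/polyP=> k.
  by rewrite coef_map coef_map_id0 ?rmorph0 // coef_map /= !rmorph_int.
case: (hDelta) => hiso _ _.
by rewrite Ap -(hiso _ _ hL); apply/esym/(hp _ (markov_conway hDelta)).
Qed.
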